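(* Let $H_1$ and $H_2$ be infinite-dimensional vector spaces over a field $P$. Then $H_1$ and $H_2$ are isotyped (in the variety $\Theta$ of vector spaces over $P$).
   Context: Let $\Theta$ be the variety of vector spaces over $P$ (with scalar multiplications as unary operations). Let $X^0$ be an infinite set of variables; $X, Y$ below always denote finite subsets of $X^0$, and $W(X)$ is the free algebra of $\Theta$ over $X$ (the vector space with basis $X$). For $H\in\Theta$, the elements of the set $\mathrm{Hom}(W(X),H)$ of all homomorphisms $W(X)\to H$ are called points. Formulas. The sets $\Upsilon_X$ of formal expressions (for all finite $X\subset X^0$) are defined simultaneously by induction: each equality $w\equiv w'$ with $w,w'\in W(X)$ is in $\Upsilon_X$; if $u,v\in\Upsilon_X$ and $x\in X$, then $u\vee v$, $u\wedge v$, $\neg u$, $\exists x\,u$ are in $\Upsilon_X$; if $s:W(Y)\to W(X)$ is a homomorphism and $u\in\Upsilon_Y$, then $s_*u\in\Upsilon_X$. For $H\in\Theta$ the value $\mathrm{Val}^X_H(u)\subset \mathrm{Hom}(W(X),H)$ of $u\in\Upsilon_X$ is defined by: $\mathrm{Val}^X_H(w\equiv w')=\{\mu : \mu(w)=\mu(w')\}$; $\vee,\wedge,\neg$ are interpreted as union, intersection, complement; $\mu\in \mathrm{Val}^X_H(\exists x\,u)$ iff there is $\nu\in \mathrm{Val}^X_H(u)$ with $\mu(x')=\nu(x')$ for all $x'\in X$, $x'\ne x$; $\mu\in \mathrm{Val}^X_H(s_*u)$ iff $\mu\circ s\in \mathrm{Val}^Y_H(u)$. The algebra of formulas $\Phi(X)$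 is the quotient of $\Upsilon_X$ identifying $u$ and $v$ when $\mathrm{Val}^X_H(u)=\mathrm{Val}^X_H(v)$ for all $H\in\Theta$; it is a Boolean algebra and $\mathrm{Val}^X_H$ is well defined on it. The logical kernel of a point $\mu:W(X)\to H$ is $\mathrm{LKer}(\mu)=\{u\in\Phi(X) : \mu\in \mathrm{Val}^X_H(u)\}$; it is an ultrafilter of $\Phi(X)$. An $X$-type of $H$ is an ultrafilter of $\Phi(X)$ of the form $\mathrm{LKer}(\mu)$ for some point $\mu:W(X)\to H$. Algebras $H_1,H_2\in\Theta$ are isotyped if for every finite $X$ every $X$-type of $H_1$ is an $X$-type of $H_2$ and vice versa. *)

(* Defs.v *)
From HB Require Import structures.
From mathcomp Require Import all_boot all_order all_algebra.
From mathcomp Require Export finmap.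
From mathcomp Require Import generic_quotient.
From mathcomp Require Import boolp classical_sets cardinality.

Set Implicit Arguments.
Unset Strict Implicit.
Unset Printing Implicit Defensive.

Import GRing.Theory.
Local Open Scope classical_set_scope.
Local Open Scope ring_scope.

(* Vector spaces over P are [lmodType P], homomorphisms are [{linear _ -> _}];
   [V] plays the role of X^0 and finite sets of variables are [X : {fset V}]. *)

(* W(X): coordinate vectors indexed by the finite set X. *)
Definition freeW (P : fieldType) (V : choiceType) (X : {fset V}) : lmodType P :=
  {ffun X -> P^o}.

Definition var (P : fieldType) (V : choiceType) (X : {fset V}) (x : X) :
  freeW P X := [ffun y => (y == x)%:R].
Arguments var {P V X} x.

Section FreeW.
Variables (P : fieldType) (V : choiceType) (X : {fset V}) (H : lmodType P).

Definition freeW_lift (h : X -> H) (w : freeW P X) : H :=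
  \sum_(x : X) (w : {ffun X -> P^o}) x *: h x.

Lemma freeW_lift_is_linear h : linear (freeW_lift h).
Proof.
move=> c w w'; rewrite /freeW_lift scaler_sumr -big_split.
by apply: eq_bigr => x _; rewrite !ffunE /= scalerDl scalerA.
Qed.

HB.instance Definition _ h :=
  GRing.isLinear.Build P (freeW P X) H _ (freeW_lift h) (freeW_lift_is_linear h).

Lemma freeW_lift_var h x : freeW_lift h (var x) = h x.
Proof.
rewrite /freeW_lift (bigD1 x) //= ffunE eqxx scale1r big1 ?addr0 // => y /negPf xy.
by rewrite ffunE xy scale0r.
Qed.

Lemma freeW_sum (w : freeW P X) :
  w = \sum_(x : X) (w : {ffun X -> P^o}) x *: var x.
Proof.
apply/ffunP => y; rewrite sum_ffunE (bigD1 y) //= !ffunE eqxx.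
rewrite [_ *: _]mulr1 big1 ?addr0 // => z zy.
by rewrite !ffunE eq_sym (negPf zy) scaler0.
Qed.

Lemma freeW_lift_unique (f : {linear freeW P X -> H}) h :
  (forall x, f (var x) = h x) -> f =1 freeW_lift h.
Proof.
move=> fh w; rewrite [in LHS](freeW_sum w) linear_sum.
by apply: eq_bigr => x _; rewrite linearZ /= fh.
Qed.

End FreeW.

Inductive formula (P : fieldType) (V : choiceType) : {fset V} -> Type :=
| FEq (X : {fset V}) (w w' : freeW P X) : formula P X
| FOr (X : {fset V}) (u v : formula P X) : formula P X
| FAnd (X : {fset V}) (u v : formula P X) : formula P X
| FNot (X : {fset V}) (u : formula P X) : formula P X
| FEx (X : {fset V}) (x : X) (u : formula P X) : formula P X
| FSub (Y X : {fset V}) (s : {linear freeW P Y -> freeW P X})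
    (u : formula P Y) : formula P X.

Section Val.
Variables (P : fieldType) (V : choiceType) (H : lmodType P).

Fixpoint Val (X : {fset V}) (u : formula P X) : set {linear freeW P X -> H} :=
  match u in formula _ X return set {linear freeW P X -> H} with
  | FEq X w w' => [set mu : {linear freeW P X -> H} | mu w = mu w']
  | FOr X u v => Val u `|` Val v
  | FAnd X u v => Val u `&` Val v
  | FNot X u => ~` Val u
  | FEx X x u =>
      [set mu : {linear freeW P X -> H} |
        exists2 nu : {linear freeW P X -> H}, Val u nu &
          forall x' : X, x' != x -> mu (var x') = nu (var x')]
  | FSub Y X s u => [set mu : {linear freeW P X -> H} | Val u (mu \o s)]
  end.

End Val.
Arguments Val {P V} H {X} u.

Section Phi.
Variables (P : fieldType) (V : choiceType) (X : {fset V}).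

(* Classical choice structure, required by [{eq_quot _}]. *)
HB.instance Definition _ := gen_eqMixin (formula P X).
HB.instance Definition _ := gen_choiceMixin (formula P X).

Definition sem_eq (u v : formula P X) : bool :=
  `[< forall H : lmodType P, Val H u = Val H v >].

Lemma sem_eq_equiv : equiv_class_of sem_eq.
Proof.
split => [u|u v|v u w].
- exact/asboolP.
- by apply/asboolP/asboolP => uv H; rewrite uv.
- by move=> /asboolP uv /asboolP vw; apply/asboolP => H; rewrite uv vw.
Qed.

Canonical sem_eq_equiv_rel := EquivRelPack sem_eq_equiv.

Definition Phi := {eq_quot sem_eq}%qT.

HB.instance Definition _ := Choice.on Phi.
HB.instance Definition _ := EqQuotient.on Phi.

Definition ValPhi (H : lmodType P) (a : Phi) : set {linear freeW P X -> H} :=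
  Val H (repr a).
Arguments ValPhi : clear implicits.

Lemma ValPhi_pi (H : lmodType P) u : ValPhi H (\pi_Phi u)%qT = Val H u.
Proof.
have /eqmodP/asboolP : (repr (\pi_Phi u) = u %[mod Phi])%qT by rewrite reprK.
exact.
Qed.

Lemma Phi_eq (a b : Phi) : (forall H, ValPhi H a = ValPhi H b) -> a = b.
Proof.
by move=> ab; rewrite -(reprK a) -(reprK b); apply/eqmodP/asboolP => H; apply: ab.
Qed.

Definition phi_or (a b : Phi) : Phi := (\pi_Phi (FOr (repr a) (repr b)))%qT.
Definition phi_and (a b : Phi) : Phi := (\pi_Phi (FAnd (repr a) (repr b)))%qT.
Definition phi_not (a : Phi) : Phi := (\pi_Phi (FNot (repr a)))%qT.
Definition phi_top : Phi := (\pi_Phi (FEq (0 : freeW P X) 0))%qT.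
Definition phi_bot : Phi := phi_not phi_top.

Lemma ValPhi_or H a b : ValPhi H (phi_or a b) = ValPhi H a `|` ValPhi H b.
Proof. by rewrite ValPhi_pi. Qed.

Lemma ValPhi_and H a b : ValPhi H (phi_and a b) = ValPhi H a `&` ValPhi H b.
Proof. by rewrite ValPhi_pi. Qed.

Lemma ValPhi_not H a : ValPhi H (phi_not a) = ~` ValPhi H a.
Proof. by rewrite ValPhi_pi. Qed.

Lemma ValPhi_top H : ValPhi H phi_top = setT.
Proof. by rewrite ValPhi_pi; apply/seteqP; split. Qed.

Lemma ValPhi_bot H : ValPhi H phi_bot = set0.
Proof. by rewrite ValPhi_not ValPhi_top setCT. Qed.

Definition ValPhiE :=
  (ValPhi_or, ValPhi_and, ValPhi_not, ValPhi_top, ValPhi_bot).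

Lemma phi_andC : commutative phi_and.
Proof. by move=> a b; apply: Phi_eq => H; rewrite !ValPhiE setIC. Qed.
Lemma phi_orC : commutative phi_or.
Proof. by move=> a b; apply: Phi_eq => H; rewrite !ValPhiE setUC. Qed.
Lemma phi_andA : associative phi_and.
Proof. by move=> a b c; apply: Phi_eq => H; rewrite !ValPhiE setIA. Qed.
Lemma phi_orA : associative phi_or.
Proof. by move=> a b c; apply: Phi_eq => H; rewrite !ValPhiE setUA. Qed.
Lemma phi_orKI (b a : Phi) : phi_and a (phi_or a b) = a.
Proof. by apply: Phi_eq => H; rewrite !ValPhiE setUC setKU. Qed.
Lemma phi_andKU (b a : Phi) : phi_or a (phi_and a b) = a.
Proof. by apply: Phi_eq => H; rewrite !ValPhiE setIC setKI. Qed.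
Lemma phi_andUl : left_distributive phi_and phi_or.
Proof. by move=> a b c; apply: Phi_eq => H; rewrite !ValPhiE setIUl. Qed.
Lemma phi_andxx : idempotent_op phi_and.
Proof. by move=> a; apply: Phi_eq => H; rewrite !ValPhiE setIid. Qed.

Fact Phi_display : Order.disp_t. Proof. exact: Order.Disp tt tt. Qed.

HB.instance Definition _ := Order.isMeetJoinDistrLattice.Build Phi_display Phi
  (fun _ _ => erefl) (fun _ _ => erefl) phi_andC phi_orC phi_andA phi_orA
  phi_orKI phi_andKU phi_andUl phi_andxx.

Lemma phi_le0x (a : Phi) : (phi_bot <= a)%O.
Proof. by apply/eqP/Phi_eq => H; rewrite !ValPhiE set0I. Qed.
Lemma phi_lex1 (a : Phi) : (a <= phi_top)%O.
Proof. by apply/eqP/Phi_eq => H; rewrite !ValPhiE setIT. Qed.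

HB.instance Definition _ := Order.hasBottom.Build Phi_display Phi phi_le0x.
HB.instance Definition _ := Order.hasTop.Build Phi_display Phi phi_lex1.

Lemma phi_orxC (a : Phi) : phi_or a (phi_not a) = phi_top.
Proof. by apply: Phi_eq => H; rewrite !ValPhiE setUCr. Qed.
Lemma phi_andxC (a : Phi) : phi_and a (phi_not a) = phi_bot.
Proof. by apply: Phi_eq => H; rewrite !ValPhiE setICr. Qed.

HB.instance Definition _ :=
  Order.TBDistrLattice_hasComplement.Build Phi_display Phi phi_orxC phi_andxC.

End Phi.
Arguments ValPhi {P V X} H a.

Section Ultrafilter.
Variables (d : Order.disp_t) (B : Order.CTBDistrLattice.type d).

Definition proper_filter (F : set B) : Prop :=
  [/\ F \top%O, ~ F \bot%O, forall a b, F a -> F b -> F (a `&` b)%O &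
      forall a b, (a <= b)%O -> F a -> F b].

Definition ultrafilter (F : set B) : Prop :=
  proper_filter F /\ forall G : set B, proper_filter G -> F `<=` G -> G = F.

End Ultrafilter.

Section Types.
Variables (P : fieldType) (V : choiceType).

Definition LKer (X : {fset V}) (H : lmodType P) (mu : {linear freeW P X -> H}) :
  set (Phi P X) := [set a | ValPhi H a mu].

Lemma LKer_ultrafilter (X : {fset V}) (H : lmodType P)
  (mu : {linear freeW P X -> H}) : ultrafilter (LKer mu).
Proof.
split.
  split; rewrite /LKer /=.
  - by rewrite ValPhi_top.
  - by rewrite ValPhi_bot.
  - by move=> a b Fa Fb; rewrite ValPhi_and.
  - by move=> a b /eqP <-; rewrite ValPhi_and => -[].
move=> G [_ G0 GI _] FG; apply/seteqP; split=> // a Ga.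
apply: contrapT => nFa; apply: G0.
suff : G (phi_and a (phi_not a)) by rewrite phi_andxC.
apply: GI => //; apply: FG.
by rewrite /LKer /= ValPhi_not.
Qed.

Definition is_type (X : {fset V}) (H : lmodType P) (T : set (Phi P X)) : Prop :=
  ultrafilter T /\ exists mu : {linear freeW P X -> H}, T = LKer mu.

Definition isotyped (H1 H2 : lmodType P) : Prop :=
  forall (X : {fset V}) (T : set (Phi P X)), is_type H1 T <-> is_type H2 T.

End Types.
Arguments isotyped {P} V H1 H2.

Definition finite_dimensional (P : fieldType) (H : lmodType P) : Prop :=
  exists (n : nat) (b : 'I_n -> H),
    forall v : H, exists c : 'I_n -> P, v = \sum_(i < n) c i *: b i.

Definition infinite_dimensional (P : fieldType) (H : lmodType P) : Prop :=
  ~ finite_dimensional H.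

(* Main.v *)
Require Import Defs.
From mathcomp Require Import all_boot all_algebra.
From mathcomp Require Import classical_sets cardinality.
From mathcomp Require Import boolp.

(** The truth of a formula at a point [mu] of an infinite-dimensional space
    depends on the kernel of [mu] alone ([same_ker_Val]), and every kernel of a
    point of one infinite-dimensional space is the kernel of a point of any
    other ([same_ker_exists]).  Hence the logical kernels of the points of [H1]
    are exactly those of the points of [H2].

    Both facts rest on one step of a back-and-forth argument
    ([same_ker_extend]).  Let [mu] and [nu] have the same kernel, and let [mu']
    differ from [mu] only in the value [h] of one variable [x].  If [h] is a
    combination of the values of [mu] at the other variables, the same
    combination of the values of [nu] is a suitable new value for [nu] at [x].
    Otherwise [h] enters no relation with these values, and any vector outside
    the finite-dimensional image of [nu] will do; infinite dimension provides
    one.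

    This step is the existential quantifier in an induction on formulas, the
    other connectives being immediate.  Applied to one variable at a time,
    starting from the zero points, it also produces a point with a given
    kernel. *)

Set Implicit Arguments.
Unset Strict Implicit.
Unset Printing Implicit Defensive.

Import GRing.Theory.
Local Open Scope ring_scope.

Section FreePoints.
Variables (P : fieldType) (V : choiceType) (X : {fset V}).

Definition coef (w : freeW P X) (x : X) : P := (w : {ffun X -> P^o}) x.

Definition delete (x : X) (w : freeW P X) : freeW P X := w - coef w x *: var x.

Lemma coef_delete x w : coef (delete x w) x = 0.
Proof. by rewrite /coef !ffunE eqxx [_ *: _]mulr1 subrr. Qed.

Lemma coefN w x : coef (- w) x = - coef w x.
Proof. by rewrite /coef ffunE. Qed.

Lemma coefZ c w x : coef (c *: w) x = c * coef w x.
Proof. by rewrite /coef ffunE. Qed.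

Lemma linear_delete (H : lmodType P) (mu : {linear freeW P X -> H}) x w :
  mu w = mu (delete x w) + coef w x *: mu (var x).
Proof. by rewrite /delete linearB linearZ /= subrK. Qed.

Lemma eq_linear_off (H : lmodType P) (mu mu' : {linear freeW P X -> H}) x w :
    (forall y, y != x -> mu (var y) = mu' (var y)) -> coef w x = 0 ->
  mu w = mu' w.
Proof.
move=> off wx0; rewrite (freeW_sum w) !linear_sum; apply: eq_bigr => y _.
rewrite !linearZ /=; have [->|/off -> //] := eqVneq y x.
by rewrite [(w : {ffun X -> P^o}) x]wx0 !scale0r.
Qed.

Lemma eq_linear_var (H : lmodType P) (mu mu' : {linear freeW P X -> H}) :
  (forall x, mu (var x) = mu' (var x)) -> mu =1 mu'.
Proof.
move=> E w; rewrite (freeW_lift_unique E).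
exact/esym/freeW_lift_unique.
Qed.

(** The image of a point is spanned by the values of the finitely many
    variables. *)
Lemma infinite_dim_not_onto (H : lmodType P) (mu : {linear freeW P X -> H}) :
  infinite_dimensional H -> exists h, forall w, mu w <> h.
Proof.
move=> infH; apply: contrapT => onto; apply: infH.
exists #|{: X}|, (fun i => mu (var (enum_val i))) => h.
have [w <-] : exists w, mu w = h.
  by apply: contrapT => nw; apply: onto; exists h => w E; apply: nw; exists w.
exists (fun i => coef w (enum_val i)).
rewrite {1}(freeW_sum w) linear_sum (reindex (@enum_val {: X} {: X})) /=.
  by apply: eq_bigr => i _; rewrite linearZ.
exact/onW_bij/enum_val_bij.
Qed.

(** If the value at [x] is independent of the values at the other variables, no
    relation between the values of all variables involves [x]. *)
Lemma ker_independent (H : lmodType P) (mu : {linear freeW P X -> H}) x w :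
    (forall v, coef v x = 0 -> mu v <> mu (var x)) ->
  mu w = 0 <-> coef w x = 0 /\ mu (delete x w) = 0.
Proof.
move=> indep; split=> [muw0|[wx0 mud0]]; last first.
  by rewrite (linear_delete _ x) wx0 scale0r mud0 addr0.
have wx0 : coef w x = 0.
  apply: contrapT => /eqP wxn0.
  (* Otherwise the relation can be solved for [mu (var x)]. *)
  apply: (indep (- ((coef w x)^-1 *: delete x w))).
    by rewrite coefN coefZ coef_delete mulr0 oppr0.
  move: muw0; rewrite (linear_delete _ x) => /eqP.
  rewrite addr_eq0 => /eqP mudE.
  by rewrite linearN linearZ /= mudE scalerN opprK scalerA mulVf // scale1r.
by split=> //; move: muw0; rewrite (linear_delete _ x) wx0 scale0r addr0.
Qed.

End FreePoints.

Section SameKernel.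
Variables (P : fieldType) (V : choiceType).

Definition same_ker (X : {fset V}) (H1 H2 : lmodType P)
    (mu : {linear freeW P X -> H1}) (nu : {linear freeW P X -> H2}) : Prop :=
  forall w, mu w = 0 <-> nu w = 0.

Lemma same_ker_sym (X : {fset V}) (H1 H2 : lmodType P)
    (mu : {linear freeW P X -> H1}) (nu : {linear freeW P X -> H2}) :
  same_ker mu nu -> same_ker nu mu.
Proof. by move=> K w; split=> /K. Qed.

(** The back-and-forth step.  The value of [nu'] at [x] is either forced by a
    relation, which [nu] shares with [mu], or generic. *)
Lemma same_ker_extend (X : {fset V}) (H1 H2 : lmodType P)
    (mu mu' : {linear freeW P X -> H1}) (nu : {linear freeW P X -> H2}) x :
    infinite_dimensional H2 -> same_ker mu nu ->
    (forall y, y != x -> mu (var y) = mu' (var y)) ->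
  exists2 nu' : {linear freeW P X -> H2}, same_ker mu' nu' &
    forall y, y != x -> nu (var y) = nu' (var y).
Proof.
move=> infH2 K mu_off.
pose ext (h : H2) : {linear freeW P X -> H2} :=
  freeW_lift (fun y : X => if y == x then h else nu (var y)).
have ext_off h y : y != x -> nu (var y) = ext h (var y).
  by move=> /negPf yx; rewrite /= freeW_lift_var yx.
have ext_x h : ext h (var x) = h by rewrite /= freeW_lift_var eqxx.
have mu_del w : mu' (delete x w) = mu (delete x w).
  exact/esym/(eq_linear_off mu_off)/coef_delete.
have ext_del h w : ext h (delete x w) = nu (delete x w).
  exact/esym/(eq_linear_off (ext_off h))/coef_delete.
have [[v vx0 mu'x]|indep] :=
    pselect (exists2 v, coef v x = 0 & mu' v = mu' (var x)).
  exists (ext (nu v)) => [w|]; last exact: ext_off.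
  (* On both sides, evaluating [w] amounts to substituting [v] for [x] in it. *)
  rewrite (linear_delete mu' x) (linear_delete (ext _) x) ext_x mu_del ext_del.
  rewrite -mu'x -(eq_linear_off mu_off vx0) -!linearZ -!linearD.
  exact: K.
have [h nuh] := infinite_dim_not_onto nu infH2.
exists (ext h) => [w|]; last exact: ext_off.
have -> : mu' w = 0 <-> coef w x = 0 /\ mu' (delete x w) = 0.
  by apply: ker_independent => v vx0 E; apply: indep; exists v.
have -> : ext h w = 0 <-> coef w x = 0 /\ ext h (delete x w) = 0.
  apply: ker_independent => v vx0.
  by rewrite ext_x -(eq_linear_off (ext_off h) vx0).
by rewrite mu_del ext_del; split=> -[-> /K].
Qed.

(** The values of the variables are prescribed one after the other: on the way,
    [part s] is the point with the values of [mu] on [s] and zero elsewhere. *)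
Lemma same_ker_exists (X : {fset V}) (H1 H2 : lmodType P)
    (mu : {linear freeW P X -> H1}) :
    infinite_dimensional H2 ->
  exists nu : {linear freeW P X -> H2}, same_ker mu nu.
Proof.
move=> infH2.
pose part (s : seq X) : {linear freeW P X -> H1} :=
  freeW_lift (fun y : X => if y \in s then mu (var y) else 0).
have partE s y : part s (var y) = if y \in s then mu (var y) else 0.
  by rewrite /= freeW_lift_var.
have [nu K] : exists nu : {linear freeW P X -> H2},
    same_ker (part (enum {: X})) nu.
  elim: (enum {: X}) => [|x s [nu K]].
    exists (freeW_lift (fun=> 0)) => w.
    by rewrite /= /freeW_lift !big1 // => y _; rewrite scaler0.
  have off y : y != x -> part s (var y) = part (x :: s) (var y).
    by move=> /negPf yx; rewrite !partE inE yx.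
  by have [nu' K' _] := same_ker_extend infH2 K off; exists nu'.
exists nu => w; rewrite -(K w) (@eq_linear_var _ _ _ _ mu (part (enum {: X}))) //.
by move=> x; rewrite partE mem_enum.
Qed.

(** Only the existential quantifier needs infinite dimension: a witness in either
    space is carried to the other by [same_ker_extend]. *)
Lemma same_ker_Val (H1 H2 : lmodType P) :
    infinite_dimensional H1 -> infinite_dimensional H2 ->
  forall (X : {fset V}) (u : formula P X)
    (mu : {linear freeW P X -> H1}) (nu : {linear freeW P X -> H2}),
  same_ker mu nu -> Val H1 u mu <-> Val H2 u nu.
Proof.
move=> infH1 infH2 X; elim=> {X} /=.
- move=> X w w' mu nu /(_ (w - w')); rewrite !linearB => K.
  by split=> /eqP; rewrite -subr_eq0 => /eqP/K/eqP; rewrite subr_eq0 => /eqP.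
- by move=> X u IHu v IHv mu nu K; rewrite /setU /= (IHu _ _ K) (IHv _ _ K).
- by move=> X u IHu v IHv mu nu K; rewrite /setI /= (IHu _ _ K) (IHv _ _ K).
- by move=> X u IHu mu nu K; rewrite /setC /= (IHu _ _ K).
- move=> X x u IHu mu nu K; split=> -[mu' u_mu' off].
    have [nu' K' off'] := same_ker_extend infH2 K off.
    by exists nu' => //; apply/(IHu _ _ K').
  have [nu' K' off'] := same_ker_extend infH1 (same_ker_sym K) off.
  by exists nu' => //; apply/(IHu _ _ (same_ker_sym K')).
- by move=> Y X s u IHu mu nu K; apply: IHu => w; apply: K.
Qed.

Lemma is_type_transfer (H1 H2 : lmodType P) (X : {fset V})
    (T : classical_sets.set (Phi P X)) :
    infinite_dimensional H1 -> infinite_dimensional H2 ->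
  is_type H1 T -> is_type H2 T.
Proof.
move=> infH1 infH2 [ultraT [mu TE]]; split=> //.
have [nu K] := same_ker_exists mu infH2; exists nu; rewrite TE.
by apply/seteqP; split=> a;
   move=> /(same_ker_Val infH1 infH2 (generic_quotient.repr a) K).
Qed.

End SameKernel.

Theorem proposition3p4 (P : fieldType) (V : choiceType)
  (infV : infinite_set [set: V]%classic) (H1 H2 : lmodType P)
  (infH1 : infinite_dimensional H1) (infH2 : infinite_dimensional H2) :
  isotyped V H1 H2.
Proof. by move=> X T; split; apply: is_type_transfer. Qed.
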